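(* Let $k$ be an algebraically closed field of characteristic $p>0$ and let $d\geq 4$ be an integer not divisible by $p$. Then there exist reduced homogeneous polynomials $f\in k[x,y]$ of degree $d$ whose $F$-pure threshold is $\langle \frac{2}{d}\rangle_L$ for some positive integer $L$. In particular, for at least one $L$ the set of reduced homogeneous polynomials of degree $d$ in $k[x,y]$ with $F$-pure threshold exactly $\langle\frac2d\rangle_L$ is non-empty.
   Context: A nonzero homogeneous polynomial is reduced if it has no repeated irreducible factors. For a nonzero homogeneous $f\in k[x,y]$ of positive degree, $\mathrm{fpt}(f)=\sup\{N/p^e : f^N\notin (x^{p^e},y^{p^e})\}=\inf\{N/p^e: f^N\in(x^{p^e},y^{p^e})\}$. For a real number $0<\lambda\le 1$, write its unique non-terminating base $p$ expansion $\lambda=\sum_{i\ge1}\alpha_i/p^i$ (integers $0\le\alpha_i\le p-1$, the sequence $(\alpha_i)$ not eventually zero). Then $\langle\lambda\rangle_e:=\sum_{i=1}^e\alpha_i/p^i$; equivalently $\langle \lambda\rangle_e=N_e/p^e$ with $N_e$ the unique integer such that $0<\lambda-N_e/p^e\le 1/p^e$. *)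

(* Defs.v *)
From HB Require Import structures.
From mathcomp Require Import all_boot all_order all_algebra.
(* mpoly has to be imported before the analysis files: their notations clash
   in the other order. *)
From mathcomp Require Import mpoly.
From mathcomp Require Import boolp classical_sets reals topology normedtype.
From mathcomp Require Import sequences.
Set Implicit Arguments.
Unset Strict Implicit.
Unset Printing Implicit Defensive.
Import Order.TTheory GRing.Theory Num.Theory.
Import numFieldNormedType.Exports.
Local Open Scope classical_set_scope.
Local Open Scope ring_scope.

Definition irreducible_elt (A : idomainType) (a : A) : Prop :=
  [/\ a != 0, a \isn't a GRing.unit &
      forall b c : A, a = b * c ->
        b \is a GRing.unit \/ c \is a GRing.unit].

Definition reduced (k : fieldType) (f : {mpoly k[2]}) : Prop :=
  f != 0 /\
  forall g : {mpoly k[2]}, irreducible_elt g -> ~ exists h, f = g ^+ 2 * h.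

(* The ideal (x^q, y^q) of k[x, y]. *)
Definition monomial_ideal (k : fieldType) (q : nat) : set {mpoly k[2]} :=
  [set h | exists a b : {mpoly k[2]},
     h = a * 'X_(ord0) ^+ q + b * 'X_(ord_max) ^+ q].

(* When f has zero constant term, the set below contains 0 (take N = 0) and is
   bounded by 2, so that [sup] is its actual least upper bound. *)
Definition fpt (R : realType) (k : fieldType) (p : nat) (f : {mpoly k[2]}) : R :=
  sup [set r : R | exists N e : nat,
         ~ monomial_ideal (p ^ e) (f ^+ N) /\ r = N%:R / p%:R ^+ e].

(* The digits are alpha 1, alpha 2, ...; the value alpha 0 is never used. *)
Definition digit_sum (R : realType) (p : nat) (alpha : nat -> nat) (e : nat) : R :=
  \sum_(1 <= i < e.+1) (alpha i)%:R / p%:R ^+ i.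

Definition nonterminating_expansion (R : realType) (p : nat) (lam : R)
    (alpha : nat -> nat) : Prop :=
  [/\ forall i, (alpha i < p)%N,
      forall n, exists2 i, (n <= i)%N & alpha i != 0%N &
      digit_sum R p alpha e @[e --> \oo] --> lam].

(* [get] selects some expansion of lam; by [truncationP] below the result does
   not depend on which one when 1 < p and 0 < lam <= 1. *)
Definition truncation (R : realType) (p : nat) (lam : R) (e : nat) : R :=
  digit_sum R p (get (nonterminating_expansion p lam)) e.

Lemma digit_sumS (R : realType) p (alpha : nat -> nat) e :
  digit_sum R p alpha e.+1 =
  digit_sum R p alpha e + (alpha e.+1)%:R / p%:R ^+ e.+1.
Proof. by rewrite /digit_sum big_nat_recr. Qed.

Lemma digit_sum_le (R : realType) p (alpha : nat -> nat) m n :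
  (m <= n)%N -> digit_sum R p alpha m <= digit_sum R p alpha n.
Proof.
move=> /subnKC <-; elim: (n - m)%N => [|j IHj]; first by rewrite addn0.
rewrite addnS digit_sumS (le_trans IHj) // lerDl.
by rewrite divr_ge0 ?ler0n // exprn_ge0.
Qed.

Lemma digit_sum_tail (R : realType) p (alpha : nat -> nat) m n :
  (1 < p)%N -> (forall i, (alpha i < p)%N) -> (m <= n)%N ->
  digit_sum R p alpha n + (p%:R ^+ n)^-1 <=
  digit_sum R p alpha m + (p%:R ^+ m)^-1.
Proof.
move=> p_gt1 ap /subnKC <-.
have pX_gt0 j : 0 < p%:R ^+ j :> R by rewrite exprn_gt0 // ltr0n ltnW.
elim: (n - m)%N => [|j IHj]; first by rewrite addn0.
rewrite addnS (le_trans _ IHj) // digit_sumS -addrA lerD2l.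
rewrite -[X in _ + X]mul1r -mulrDl ler_pdivrMr // exprS mulrC mulfK ?gt_eqF //.
by rewrite natr1 ler_nat.
Qed.

Lemma digit_sum_nat (R : realType) p (alpha : nat -> nat) e :
  (1 < p)%N -> exists N : nat, digit_sum R p alpha e = N%:R / p%:R ^+ e.
Proof.
move=> p_gt1; have p0 : p%:R != 0 :> R by rewrite pnatr_eq0 -lt0n ltnW.
elim: e => [|e [N IHe]]; first by exists 0%N; rewrite /digit_sum big_geq ?mul0r.
exists (N * p + alpha e.+1)%N; rewrite digit_sumS IHe natrD natrM mulrDl.
by congr (_ + _); rewrite exprS invfM mulrA mulfK.
Qed.

Lemma expansion_bounds (R : realType) p (lam : R) alpha e :
  (1 < p)%N -> nonterminating_expansion p lam alpha ->
  0 < lam - digit_sum R p alpha e <= (p%:R ^+ e)^-1.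
Proof.
move=> p_gt1 [ap anz acv].
have pX_gt0 j : 0 < p%:R ^+ j :> R by rewrite exprn_gt0 // ltr0n ltnW.
have acvg : cvgn (digit_sum R p alpha) by apply/cvg_ex; exists lam.
have sum_le m : digit_sum R p alpha m <= lam.
  rewrite -(cvg_lim _ acv) //; apply: nondecreasing_cvgn_le acvg _.
  by move=> i j; exact: digit_sum_le.
apply/andP; split.
  have [[|i] lei ai] := anz e.+1; first by [].
  rewrite subr_gt0 (lt_le_trans _ (sum_le i.+1)) // digit_sumS.
  rewrite (le_lt_trans (@digit_sum_le _ _ _ e i lei)) // ltrDl.
  by rewrite divr_gt0 // ltr0n lt0n.
rewrite lerBlDl -(cvg_lim _ acv) //; apply: limr_le => //.
exists e => // n /= len; apply: le_trans (digit_sum_tail _ p_gt1 ap len).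
by rewrite lerDl invr_ge0 ltW.
Qed.

Lemma expansion_exists (R : realType) p (lam : R) :
  (1 < p)%N -> 0 < lam <= 1 -> exists alpha, nonterminating_expansion p lam alpha.
Proof.
move=> p_gt1 /andP[lam_gt0 lam_le1].
have pX_gt0 j : 0 < p%:R ^+ j :> R by rewrite exprn_gt0 // ltr0n ltnW.
have /choice[N NP] e : exists N : nat, N%:R < lam * p%:R ^+ e <= N.+1%:R.
  have x_gt0 : 0 < lam * p%:R ^+ e by rewrite mulr_gt0.
  have [M xM] : exists M : nat, lam * p%:R ^+ e <= M%:R.
    exists (Num.truncn (lam * p%:R ^+ e)).+1.
    by rewrite ltW // truncnS_gt.
  case: (@ex_minnP (fun m : nat => lam * p%:R ^+ e <= m%:R)); first by exists M.
  case=> [|m] xm mmin; first by move: xm; rewrite leNgt x_gt0.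
  exists m; rewrite xm andbT ltNge; apply/negP => /mmin.
  by rewrite ltnn.
have N0 : N 0%N = 0%N.
  have /andP[+ _] := NP 0%N; rewrite expr0 mulr1 => /lt_le_trans/(_ lam_le1).
  by rewrite (ltr_nat R (N 0%N) 1); case: (N 0%N).
have Nlo e : (N e * p <= N e.+1)%N.
  have /andP[lo _] := NP e; have /andP[_ hi] := NP e.+1.
  rewrite -ltnS -(ltr_nat R) natrM (lt_le_trans _ hi) // exprSr mulrA.
  by rewrite ltr_pM2r // ltr0n ltnW.
have Nhi e : (N e.+1 < N e * p + p)%N.
  have /andP[_ hi] := NP e; have /andP[lo _] := NP e.+1.
  rewrite -(ltr_nat R) -mulSnr natrM (lt_le_trans lo) // exprSr mulrA.
  by rewrite ler_pM2r // ltr0n ltnW.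
pose alpha i := (N i - N i.-1 * p)%N.
have ap i : (alpha i < p)%N.
  case: i => [|i]; first by rewrite /alpha N0 ltnW.
  by rewrite /alpha ltn_subLR.
have sumE e : digit_sum R p alpha e = (N e)%:R / p%:R ^+ e.
  elim: e => [|e IHe]; first by rewrite /digit_sum big_geq // N0 mul0r.
  rewrite digit_sumS IHe /alpha /= natrB // mulrBl natrM exprS invfM.
  rewrite [X in _ - X]mulrA mulfK ?pnatr_eq0 -?lt0n 1?ltnW //.
  by rewrite addrC subrK.
have gap e : 0 < lam - digit_sum R p alpha e <= (p%:R ^+ e)^-1.
  have /andP[lo hi] := NP e; rewrite sumE subr_gt0 ltr_pdivrMr // lo /=.
  rewrite lerBlDl -[X in _ + X]mul1r -mulrDl ler_pdivlMr //.
  by rewrite natr1.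
have acv : digit_sum R p alpha e @[e --> \oo] --> lam.
  apply/cvgrPdist_le => /= eps eps_gt0.
  have q1 : `|p%:R^-1 : R| < 1.
    by rewrite ger0_norm ?invr_ge0 // invf_lt1 ?ltr1n // ltr0n ltnW.
  have /cvgr0_norm_le/(_ _ eps_gt0) := cvg_expr q1.
  apply: filterS => e le_eps; have /andP[lo hi] := gap e.
  rewrite ger0_norm; last exact: ltW.
  rewrite (le_trans hi) // (le_trans _ le_eps) //.
  by rewrite exprVn ler_norm.
exists alpha; split=> // n; apply: contrapT => nz.
have cst m : (n <= m)%N -> digit_sum R p alpha m = digit_sum R p alpha n.
  move=> /subnKC <-; elim: (m - n)%N => [|j IHj]; first by rewrite addn0.
  rewrite addnS digit_sumS IHj; have [->|a_nz] := eqVneq (alpha (n + j).+1) 0%N.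
    by rewrite mul0r addr0.
  by case: nz; exists (n + j).+1 => //; rewrite leqW // leq_addr.
have /andP[+ _] := gap n; rewrite subr_gt0 -(cvg_lim _ acv) // ltNge.
case/negP; apply: limr_le; first by apply/cvg_ex; exists lam.
by exists n => // m /= /cst ->.
Qed.

Lemma truncationP (R : realType) p (lam : R) e (N : nat) :
  (1 < p)%N -> 0 < lam <= 1 ->
  truncation p lam e = N%:R / p%:R ^+ e <->
  0 < lam - N%:R / p%:R ^+ e <= (p%:R ^+ e)^-1.
Proof.
move=> p_gt1 lam01; have /cid[alpha alphaP] := expansion_exists p_gt1 lam01.
have := expansion_bounds e p_gt1 (getI alphaP); rewrite /truncation.
have [M ->] := digit_sum_nat R (get (nonterminating_expansion p lam)) e p_gt1.
have pX_gt0 : 0 < p%:R ^+ e :> R by rewrite exprn_gt0 // ltr0n ltnW.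
have aux A B : 0 < lam - A%:R / p%:R ^+ e <= (p%:R ^+ e)^-1 ->
    0 < lam - B%:R / p%:R ^+ e <= (p%:R ^+ e)^-1 -> (A <= B)%N.
  move=> /andP[+ _] /andP[_]; rewrite subr_gt0 lerBlDl -[X in _ + X]mul1r -mulrDl.
  move=> /[swap] /lt_le_trans/[apply]; rewrite ltr_pM2r ?invr_gt0 //.
  by rewrite natr1 ltr_nat.
move=> MP; split=> [<- //|NP].
by have -> : M = N by apply/eqP; rewrite eqn_leq !aux.
Qed.

(* Main.v *)
Require Import Defs.
From HB Require Import structures.
From mathcomp Require Import all_boot all_order all_algebra.
From mathcomp Require Import perm cyclic separable cyclotomic.
From mathcomp Require Import mpoly.
From mathcomp Require Import zify ring.
From mathcomp Require Import boolp classical_sets reals topology normedtype.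
From mathcomp Require Import sequences.
Set Implicit Arguments.
Unset Strict Implicit.
Unset Printing Implicit Defensive.
Import Order.TTheory GRing.Theory Num.Theory.
Import numFieldNormedType.Exports.
Local Open Scope classical_set_scope.
Local Open Scope ring_scope.

(* Idea. A form of degree d is handled through its dehomogenization F.

   For a reduced f of degree d, with d invertible in k, the partial derivatives
   of f are coprime forms of degree d - 1, so the Jacobian ideal contains every
   form of degree 2d - 3. Put q = p^e. If f^M is in (x^q, y^q) but f^(M-1) is
   not, and p does not divide M, then differentiating f^M places
   f^(M-1) (x, y)^(2d-3) in (x^q, y^q), which by degrees forces
   d M >= 2q - d + 2. Hence, as soon as f^N is in (x^q, y^q) for some N and q
   with N/q < 2/d, the threshold is N_L/p^L for the least L such that f^(N_L) is
   in (x^(p^L), y^(p^L)), where N_e = ceil(2 p^e/d) - 1; and N_L/p^L is the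
   truncation of 2/d at L.

   To get such an f, take q = p^e = 1 mod d and M = (q - 1)/d. Only the
   coefficient C(f) of (xy)^(q-1) in f^(2M) has to vanish. If C vanishes at no
   reduced form, move one root t of f = h (x - t y): the polynomial C(h (x - t y))
   in t has a root, which must be a root of h. This is excluded for generic h,
   because C does not vanish on all forms with a double root, as
   (xy)^(d/2) or (xy)^((d-1)/2) (x + y) shows; when the binomial coefficient
   this gives is 0 in k, the form x^d - y^d already has C = 0. *)

(** * The ideals (x^Q, y^Q) and the Jacobian ideal *)

(* The form [\sum_i G_i x^i y^(D - i)] of degree [D] lies in [(x^Q, y^Q)]; see
   [monomial_ideal_homogenize]. *)
Definition frob_mem (k : nzRingType) (D Q : nat) (G : {poly k}) : Prop :=
  forall i, (i < Q)%N -> (D < i + Q)%N -> G`_i = 0.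

Lemma frob_memM (k : nzRingType) D E Q (G H : {poly k}) :
  frob_mem D Q G -> (size H <= E.+1)%N -> frob_mem (D + E) Q (G * H).
Proof.
move=> GQ sH i iQ DEQ; rewrite coefM big1 // => -[j /= ji] _.
have [ijE|Eij] := leqP (i - j) E; last by rewrite [H`__]nth_default ?mulr0 // (leq_trans sH).
by rewrite GQ ?mul0r //; lia.
Qed.

Lemma frob_mem_sum_mul (k : comNzRingType) D E Q (G A B w a b : {poly k}) :
  frob_mem D Q (G * A) -> frob_mem D Q (G * B) ->
  (size a <= E.+1)%N -> (size b <= E.+1)%N -> w = a * A + b * B ->
  frob_mem (D + E) Q (G * w).
Proof.
move=> GA GB sa sb -> i iQ DQ.
have -> : G * (a * A + b * B) = G * A * a + G * B * b by ring.
by rewrite coefD (frob_memM GA sa) // (frob_memM GB sb) // addr0.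
Qed.

(* Colon ideal: [((x^Q, y^Q) : (x, y)^E)] contains no new forms of degree [D]
   when [D + E <= 2 Q - 2]. *)
Lemma frob_mem_colon (k : nzRingType) D E Q (G : {poly k}) :
  (D + E + 2 <= 2 * Q)%N ->
  (forall u, (u <= E)%N -> frob_mem (D + E) Q (G * 'X^u)) -> frob_mem D Q G.
Proof.
(* The largest shift up to [E] keeping [i + u < Q]. If [u = E], the bound [D < i + Q] carries over;
   if [i + u = Q - 1], the bound on [D + E] is used. *)
move=> DEQ Gu i iQ DQ; pose u := minn E (Q.-1 - i).
have := Gu u (geq_minl _ _) (i + u)%N.
have iu : (i + u < u)%N = false by lia.
by rewrite coefMXn addnK iu; apply; lia.
Qed.

(* Dehomogenization of the partial derivative in [y] of the degree [d] form
   attached to [F]; the one in [x] becomes [F^`()]. *)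
Definition dehom_dy (k : nzRingType) (d : nat) (F : {poly k}) : {poly k} :=
  F *+ d - 'X * F^`().

Lemma coef_dehom_dy (k : nzRingType) d (F : {poly k}) i :
  (dehom_dy d F)`_i = F`_i *+ d - F`_i *+ i.
Proof.
rewrite coefB coefMn coefXM; case: i => [|i] //=; last by rewrite coef_deriv.
Qed.

Lemma size_dehom_dy (k : nzRingType) d (F : {poly k}) :
  (size F <= d.+1)%N -> (size (dehom_dy d F) <= d)%N.
Proof.
move=> sF; apply/leq_sizeP => j; rewrite coef_dehom_dy leq_eqVlt.
move=> /predU1P[->|dj]; first by rewrite subrr.
by rewrite nth_default ?mul0rn ?subr0 // (leq_trans sF).
Qed.

(** As [p] divides [Q = p ^ e], both partial derivatives kill [x^Q] and [y^Q], hence preserve the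
    ideal. In coefficients, the one new index in degree [D - 1] carries the multiplier [Q], which is
    0 in [k]. *)
Lemma frob_mem_deriv (k : nzRingType) p e D (G : {poly k}) :
  p \in [pchar k] -> (0 < e)%N -> (0 < D)%N -> frob_mem D (p ^ e) G ->
  frob_mem D.-1 (p ^ e) G^`() /\ frob_mem D.-1 (p ^ e) (dehom_dy D G).
Proof.
move=> pk; case: e => // e _ D0 GQ; set Q := (p ^ e.+1)%N in GQ *.
have Q0 (x : k) : x *+ Q = 0.
  by rewrite /Q expnS mulrnA -(mulr_natl x) pcharf0 // mul0r mul0rn.
split=> i iQ DQ.
  rewrite coef_deriv; have [->|iQ'] := eqVneq i.+1 Q; first exact: Q0.
  by rewrite GQ ?mul0rn //; lia.
rewrite coef_dehom_dy; have [->|DiQ] := eqVneq D (i + Q)%N.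
  by rewrite mulrnDr Q0 addr0 subrr.
by rewrite GQ ?mul0rn ?subrr //; lia.
Qed.

(** Both partials of [F ^+ M] carry the factor [M], invertible in [k]. *)
Lemma frob_mem_exp_deriv (k : fieldType) p e d M (F : {poly k}) :
  p \in [pchar k] -> (0 < e)%N -> (0 < d)%N -> ~~ (p %| M)%N ->
  frob_mem (d * M) (p ^ e) (F ^+ M) ->
  frob_mem (d * M).-1 (p ^ e) (F ^+ M.-1 * F^`()) /\
  frob_mem (d * M).-1 (p ^ e) (F ^+ M.-1 * dehom_dy d F).
Proof.
move=> pk e0 d0 pM FM; case: M pM FM => [|M]; first by rewrite dvdn0.
move=> pM FM; have M0 : M.+1%:R != 0 :> k by rewrite -(dvdn_pcharf pk).
have [|F1 F2] := frob_mem_deriv pk e0 _ FM; first by rewrite muln_gt0 d0.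
have dyE : dehom_dy (d * M.+1) (F ^+ M.+1) = (F ^+ M * dehom_dy d F) *+ M.+1.
  rewrite /dehom_dy deriv_exp /= mulrBr mulrnBl !mulrnAr -!mulrnA -exprSr.
  by rewrite [_^`() * _]mulrC [in LHS]mulrCA.
split=> i iQ DQ; apply: (mulfI M0); rewrite mulr0.
  by have := F1 i iQ DQ; rewrite deriv_exp /= [_^`() * _]mulrC coefMn mulr_natl.
by have := F2 i iQ DQ; rewrite dyE coefMn mulr_natl.
Qed.

(* Bezout, with the degrees of the cofactors cut down by Euclidean division. *)
Lemma bezout_bounded (k : fieldType) n (A B w : {poly k}) :
  coprimep A B -> size A = n.+1 -> (size B <= n.+1)%N -> (size w <= n.*2)%N ->
  exists a b : {poly k},
    [/\ (size a <= n)%N, (size b <= n)%N & w = a * A + b * B].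
Proof.
move=> /Bezout_eq1_coprimepP[[u v] /= uv1] sA sB sw.
have A0 : A != 0 by rewrite -size_poly_eq0 sA.
pose b := (v * w) %% A; pose a := u * w + (v * w) %/ A * B.
have sb : (size b <= n)%N by rewrite -ltnS -sA ltn_modp.
have wE : w = a * A + b * B.
  rewrite -{1}[w]mul1r -uv1 /a /b mulrDl [v * B * w]mulrAC {1}(divp_eq (v * w) A).
  ring.
exists a, b; split=> //; have [->|a0] := eqVneq a 0; first by rewrite size_poly0.
have : (size (a * A)%R <= n.*2)%N.
  rewrite -[a * A](addrK (b * B)) -wE (leq_trans (size_polyD _ _)) // size_polyN.
  rewrite geq_max sw (leq_trans (size_polyMleq _ _)) //.
  by rewrite -subn1 leq_subLR add1n -addnn -addnS leq_add.
by rewrite size_mul // sA addnS /= -addnn leq_add2r.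
Qed.

(** By Euler's formula [d F] is a combination of the two partials, so separability makes them
    coprime. Bezout needs one of exact degree [d - 1]: the derivative if [F] has degree [d],
    otherwise [dehom_dy d F], whose top coefficient is then that of [F]. *)
Lemma jacobian_bezout (k : fieldType) d (F w : {poly k}) :
  d%:R != 0 :> k -> separable_poly F -> (d <= size F <= d.+1)%N ->
  (size w <= d.-1.*2)%N ->
  exists a b : {poly k}, [/\ (size a <= d.-1)%N, (size b <= d.-1)%N &
    w = a * F^`() + b * dehom_dy d F].
Proof.
case: d => [|n]; first by rewrite eqxx.
move=> d0 sepF /andP[dF Fd] sw; rewrite /= in sw *.
have F0 : F != 0 by rewrite -size_poly_gt0 (leq_trans _ dF).
have sB := size_dehom_dy Fd.
have sA : (size F^`() <= n.+1)%N by have := lt_size_deriv F0; lia.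
have copAB : coprimep F^`() (dehom_dy n.+1 F).
  rewrite /dehom_dy -scaler_nat -mulNr addrC coprimep_addl_mul coprimepZr //.
  by move: sepF; rewrite separable_poly.unlock coprimep_sym.
have [Fn|Fn] := eqVneq (F`_n.+1) 0; last first.
  have sA' : size F^`() = n.+1.
    apply/eqP; rewrite eqn_leq sA ltnNge; apply/negP => /leq_sizeP/(_ n (leqnn _)).
    by rewrite coef_deriv -mulr_natr => /eqP; rewrite mulf_eq0 (negPf Fn) (negPf d0).
  exact: bezout_bounded.
have sF : size F = n.+1.
  apply/eqP; rewrite eqn_leq dF andbT; apply/leq_sizeP => j.
  by rewrite leq_eqVlt => /predU1P[<-//|nj]; rewrite nth_default // (leq_trans Fd).
have sB' : size (dehom_dy n.+1 F) = n.+1.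
  apply/eqP; rewrite eqn_leq sB ltnNge; apply/negP => /leq_sizeP/(_ n (leqnn _)).
  rewrite coef_dehom_dy mulrS addrK => /eqP.
  by rewrite -[n in F`_n]/(n.+1.-1) -sF -lead_coefE lead_coef_eq0 (negPf F0).
have [|||b [a [sb sa ->]]] := @bezout_bounded _ n _ F^`() w _ sB' => //.
  by rewrite coprimep_sym.
by exists a, b; rewrite addrC.
Qed.

Lemma first_frob_mem_bound (k : fieldType) p e d M (F : {poly k}) :
  p \in [pchar k] -> (0 < e)%N -> (1 < d)%N -> d%:R != 0 :> k ->
  separable_poly F -> (d <= size F <= d.+1)%N -> ~~ (p %| M)%N ->
  frob_mem (d * M) (p ^ e) (F ^+ M) ->
  ~ frob_mem (d * M.-1) (p ^ e) (F ^+ M.-1) -> (2 * p ^ e + 2 <= d * M + d)%N.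
Proof.
move=> pk e0 d1 d0 sepF sF pM FM FM1; rewrite leqNgt; apply/negP => small.
have M0 : (0 < M)%N by case: (M) pM; rewrite ?dvdn0.
have dM : (d <= d * M)%N by rewrite -{1}[d]muln1 leq_pmul2l // ltnW.
have [FA FB] := frob_mem_exp_deriv pk e0 (ltnW d1) pM FM.
apply: FM1; rewrite -subn1 mulnBr muln1 subn1.
(* [2d - 3] is the degree [d - 1] of the partials plus the degree [d - 2] of the Bezout
   cofactors. *)
apply: (@frob_mem_colon _ _ (d.*2 - 3)); first by lia.
move=> u ud.
have [|a [b [sa sb wE]]] := @jacobian_bezout _ d F 'X^u d0 sepF sF.
  by rewrite size_polyXn; lia.
have := @frob_mem_sum_mul _ (d * M).-1 (d - 2) _ _ _ _ _ _ _ FA FB _ _ wE.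
have -> : ((d * M).-1 + (d - 2) = d * M - d + (d.*2 - 3))%N by lia.
by apply; rewrite (leq_trans sa, leq_trans sb); lia.
Qed.

Lemma size_exp_leq (k : nzRingType) d n (F : {poly k}) :
  (size F <= d.+1)%N -> (size (F ^+ n) <= (d * n).+1)%N.
Proof.
move=> sF; rewrite (leq_trans (size_poly_exp_leq _ _)) // ltnS leq_mul2r.
by apply/orP; right; rewrite -subn1 leq_subLR add1n.
Qed.

Lemma frob_mem_exp_le (k : nzRingType) d Q (F : {poly k}) M N :
  (size F <= d.+1)%N -> (M <= N)%N ->
  frob_mem (d * M) Q (F ^+ M) -> frob_mem (d * N) Q (F ^+ N).
Proof.
move=> sF /subnKC <- FM; rewrite mulnDr exprD; apply: frob_memM => //.
exact: size_exp_leq.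
Qed.

(** * Frobenius and [p]-th powers *)

Lemma coef_exp_pchar (k : comNzRingType) p (G : {poly k}) i :
  p \in [pchar k] -> (G ^+ p)`_i = if (p %| i)%N then G`_(i %/ p) ^+ p else 0.
Proof.
move=> pk; have p0 : (0 < p)%N := prime_gt0 (pcharf_prime pk).
have pkX : p \in [pchar {poly k}].
  by rewrite pchar_poly.
have -> : G ^+ p = \sum_(j < size G) G`_j ^+ p *: 'X^(j * p).
  rewrite -(pFrobenius_autE pkX) -{1}[G]coefK poly_def rmorph_sum.
  by apply: eq_bigr => j _; rewrite /= pFrobenius_autE exprZn exprM.
rewrite coef_sum; case: ifP => [pi|pi]; last first.
  rewrite big1 // => j _; rewrite coefZ coefXn; case: eqP => [ij|]; last by rewrite mulr0.
  by rewrite ij dvdn_mull in pi.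
have [ij|ji] := ltnP (i %/ p)%N (size G); last first.
  rewrite [G`__]nth_default // expr0n eqn0Ngt p0 big1 // => j _.
  rewrite coefZ coefXn; case: eqP => [ijp|]; last by rewrite mulr0.
  by move: ji (ltn_ord j); rewrite ijp mulnK // leqNgt => /negP.
rewrite (bigD1 (Ordinal ij)) //= coefZ coefXn divnK // eqxx mulr1 big1 ?addr0 //.
move=> j /eqP jni; rewrite coefZ coefXn; case: eqP => [ijp|]; last by rewrite mulr0.
by case: jni; apply/val_inj; rewrite /= ijp mulnK.
Qed.

(** The coefficients of [G ^+ p] sit at multiples of [p] and are [p]-th powers, which vanish only
    with their bases: in effect, the flatness of Frobenius. *)
Lemma frob_mem_frobenius (k : fieldType) p D Q (G : {poly k}) :
  p \in [pchar k] -> frob_mem (D * p) (Q * p) (G ^+ p) <-> frob_mem D Q G.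
Proof.
move=> pk; have p0 : (0 < p)%N := prime_gt0 (pcharf_prime pk).
split=> GQ i iQ DQ.
  have := GQ (i * p)%N; rewrite coef_exp_pchar // dvdn_mull // mulnK //.
  rewrite ltn_pmul2r // -mulnDl ltn_pmul2r // => /(_ iQ DQ) /eqP.
  by rewrite expf_eq0 p0 => /eqP.
rewrite coef_exp_pchar //; case: ifP => // /dvdnP[j ij].
move: iQ DQ; rewrite ij mulnK // -mulnDl !ltn_pmul2r // => jQ DjQ.
by rewrite GQ // expr0n eqn0Ngt p0.
Qed.

(** * Homogenization *)

Definition mon2 (i j : nat) : 'X_{1..2} := [multinom (if v == ord0 then i else j) | v < 2].

Lemma mon2_inj i j i' j' : mon2 i j = mon2 i' j' -> i = i' /\ j = j'.
Proof.
by move=> /mnmP eqm; move: (eqm ord0) (eqm ord_max); rewrite !mnmE.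
Qed.

Lemma mon2D i j i' j' : mon2 (i + i') (j + j') = (mon2 i j + mon2 i' j')%MM.
Proof. by apply/mnmP => v; rewrite mnmDE !mnmE; case: ifP. Qed.

Lemma X0nE (k : nzRingType) i : 'X_(ord0) ^+ i = 'X_[mon2 i 0] :> {mpoly k[2]}.
Proof.
rewrite mpolyXn; congr 'X_[_]; apply/mnmP => v; rewrite mulmnE mnm1E !mnmE.
by rewrite eq_sym; case: eqP; rewrite ?muln1 ?muln0 ?mul1n ?mul0n.
Qed.

Lemma X1nE (k : nzRingType) i : 'X_(ord_max) ^+ i = 'X_[mon2 0 i] :> {mpoly k[2]}.
Proof.
rewrite mpolyXn; congr 'X_[_]; apply/mnmP => v; rewrite mulmnE mnm1E !mnmE.
by case: v => [[|[|]]]//= ?; rewrite ?mul1n.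
Qed.

(** A factor [y] of the form lowers the degree of [F]; the range [d <= size F <= d.+1] imposed on
    separable [F] allows it at most once. *)
Definition homogenize (k : nzRingType) (d : nat) (F : {poly k}) : {mpoly k[2]} :=
  \sum_(i < d.+1) F`_i *: 'X_[mon2 i (d - i)].

Lemma homogenize_is_linear (k : nzRingType) d : linear (@homogenize k d).
Proof.
move=> a F G; rewrite /homogenize scaler_sumr -big_split /=.
by apply: eq_bigr => i _; rewrite coefD coefZ scalerDl scalerA.
Qed.

HB.instance Definition _ (k : nzRingType) d :=
  GRing.isLinear.Build k {poly k} {mpoly k[2]} _ (@homogenize k d)
    (@homogenize_is_linear k d).

Lemma homogenizeXn (k : nzRingType) d i :
  (i <= d)%N -> homogenize d 'X^i = 'X_[mon2 i (d - i)] :> {mpoly k[2]}.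
Proof.
move=> id; rewrite /homogenize (bigD1 (Ordinal (id : i < d.+1)%N)) //=.
rewrite coefXn eqxx scale1r big1 ?addr0 // => j /eqP ji.
rewrite coefXn; case: eqP => [jE|]; last by rewrite scale0r.
by case: ji; apply: val_inj.
Qed.

Lemma poly_sumE (k : nzRingType) d (F : {poly k}) :
  (size F <= d.+1)%N -> F = \sum_(i < d.+1) F`_i *: 'X^i.
Proof.
move=> sF; rewrite -poly_def; apply/polyP => i; rewrite coef_poly.
by case: ltnP => // di; rewrite nth_default // (leq_trans sF).
Qed.

Lemma homogenizeM (k : comNzRingType) d e (F G : {poly k}) :
  (size F <= d.+1)%N -> (size G <= e.+1)%N ->
  homogenize (d + e) (F * G) = homogenize d F * homogenize e G.
Proof.
move=> /poly_sumE FE /poly_sumE GE; rewrite {1}FE {1}GE big_distrlr /=.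
rewrite /homogenize -/(homogenize _ _) big_distrlr /= [LHS]linear_sum.
apply: eq_bigr => i _; rewrite linear_sum; apply: eq_bigr => j _.
rewrite -scalerAl -scalerAr -scalerAl -scalerAr -exprD !linearZ /=.
rewrite homogenizeXn; last by rewrite leq_add // -ltnS.
rewrite -mpolyXD -mon2D !scalerA mulrC; congr (_ *: 'X_[mon2 _ _]).
by move: (ltn_ord i) (ltn_ord j); lia.
Qed.

Lemma homogenizeX (k : comNzRingType) d n (F : {poly k}) :
  (size F <= d.+1)%N -> homogenize d F ^+ n = homogenize (d * n) (F ^+ n).
Proof.
move=> sF; elim: n => [|n IHn].
  rewrite !expr0 muln0 -[1 in RHS](expr0 'X) homogenizeXn // -[1]mpolyX0.
  by congr 'X_[_]; apply/mnmP => v; rewrite !mnmE; case: ifP.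
by rewrite !exprSr IHn mulnSr homogenizeM // size_exp_leq.
Qed.

Lemma mcoeff_homogenize (k : nzRingType) d i (F : {poly k}) :
  (i <= d)%N -> (homogenize d F)@_(mon2 i (d - i)) = F`_i.
Proof.
move=> id; rewrite /homogenize raddf_sum (bigD1 (Ordinal (id : i < d.+1)%N)) //=.
rewrite mcoeffZ mcoeffX eqxx mulr1 big1 ?addr0 // => j /eqP ji.
rewrite mcoeffZ mcoeffX; case: eqP => [/mon2_inj[jE _]|]; last by rewrite mulr0.
by case: ji; apply: val_inj.
Qed.

Lemma homogenize_dhomog (k : nzRingType) d (F : {poly k}) :
  homogenize d F \is d.-homog.
Proof.
apply: rpred_sum => i _; apply: rpredZ; rewrite dhomogX; apply/eqP.
rewrite /= mdegE big_ord_recl big_ord1 !mnmE /= subnKC //.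
by rewrite -ltnS.
Qed.

Lemma homogenize_neq0 (k : nzRingType) d (F : {poly k}) :
  F != 0 -> (size F <= d.+1)%N -> homogenize d F != 0.
Proof.
move=> F0 sF; apply: contra F0 => /eqP F0; rewrite -lead_coef_eq0 lead_coefE.
have sFd : ((size F).-1 <= d)%N by rewrite -subn1 leq_subLR add1n.
by rewrite -(mcoeff_homogenize _ sFd) F0 mcoeff0.
Qed.

Lemma monomial_ideal_sum (k : fieldType) Q n (E : nat -> {mpoly k[2]}) :
  (forall i, (i < n)%N -> monomial_ideal Q (E i)) ->
  monomial_ideal Q (\sum_(i < n) E i).
Proof.
elim: n => [|n IHn] EQ.
  by exists 0, 0; rewrite big_ord0 !mul0r addr0.
have [a [b ab]] := EQ n (leqnn _).
have [|a' [b' ab']] := IHn; first by move=> i /ltnW; exact: EQ.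
by exists (a' + a), (b' + b); rewrite big_ord_recr /= ab ab' !mulrDl addrACA.
Qed.

Lemma mcoeff_mulX (k : comNzRingType) (a : {mpoly k[2]}) (m n : 'X_{1..2}) v :
  (n v < m v)%N -> (a * 'X_[m])@_n = 0.
Proof.
move=> nm; apply: memN_msupp_eq0; rewrite (perm_mem (msuppMX _ _)).
by apply/mapP => -[m' _ nE]; move: nm; rewrite nE mnmDE ltnNge leq_addr.
Qed.

(** The ideal is monomial, so membership is tested monomial by monomial; [x^i y^(d - i)] lies
    outside exactly when [i < Q] and [d < i + Q]. *)
Lemma monomial_ideal_homogenize (k : fieldType) Q d (F : {poly k}) :
  (size F <= d.+1)%N ->
  monomial_ideal Q (homogenize d F) <-> frob_mem d Q F.
Proof.
move=> sF; split=> [[a [b FE]] i iQ diQ|FQ].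
  have [id|di] := leqP i d; last by rewrite nth_default // (leq_trans sF).
  rewrite -(mcoeff_homogenize _ id) FE mcoeffD X0nE X1nE.
  rewrite (@mcoeff_mulX _ _ _ _ ord0) ?mnmE //=.
  by rewrite (@mcoeff_mulX _ _ _ _ ord_max) ?mnmE ?addr0 //= ltn_subLR.
apply: (@monomial_ideal_sum _ Q d.+1 (fun i => F`_i *: 'X_[mon2 i (d - i)])).
move=> i id; have [iQ|Qi] := ltnP i Q; last first.
  exists (F`_i *: 'X_[mon2 (i - Q) (d - i)]), 0; rewrite mul0r addr0 X0nE.
  by rewrite -scalerAl -mpolyXD -mon2D subnK // addn0.
have [diQ|Qdi] := ltnP d (i + Q)%N.
  by exists 0, 0; rewrite FQ // scale0r !mul0r addr0.
exists 0, (F`_i *: 'X_[mon2 i (d - i - Q)]); rewrite mul0r add0r X1nE.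
by rewrite -scalerAl -mpolyXD -mon2D subnK ?addn0 // leq_subRL.
Qed.

Lemma homogenize_deriv (k : comNzRingType) d (F : {poly k}) :
  (size F <= d.+1)%N -> (0 < d)%N ->
  mderiv ord0 (homogenize d F) = homogenize d.-1 F^`().
Proof.
case: d => // d sF _; rewrite /homogenize raddf_sum big_ord_recl /=.
rewrite mderivZ mderivX mnmE scale0r scaler0 add0r; apply: eq_bigr => i _.
rewrite mderivZ mderivX scalerA coef_deriv mnmE /= mulr_natr; congr (_ *: 'X_[_]).
by apply/mnmP => v; rewrite mnmBE mnm1E !mnmE eq_sym; case: eqP; rewrite /bump /= ?subn0 // subn1.
Qed.

Lemma homogenize_dehom_dy (k : comNzRingType) d (F : {poly k}) :
  (size F <= d.+1)%N -> (0 < d)%N ->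
  mderiv ord_max (homogenize d F) = homogenize d.-1 (dehom_dy d F).
Proof.
case: d => // d sF _; rewrite /homogenize raddf_sum big_ord_recr /=.
rewrite mderivZ mderivX mnmE /= subnn scale0r scaler0 addr0; apply: eq_bigr => i _.
have id : (i <= d)%N by rewrite -ltnS.
rewrite mderivZ mderivX scalerA coef_dehom_dy mnmE /= -mulrnBr 1?ltnW // mulr_natr.
congr (_ *: 'X_[_]); apply/mnmP => v; rewrite mnmBE mnm1E !mnmE.
by case: v => [[|[|]]]//= ?; rewrite ?subn0 // subSn // subn1.
Qed.

(* The leading monomial of [g] divides both [x^m] and [y^n], hence is 1. *)
Lemma dvd_both_powers_unit (k : fieldType) (g u v : {mpoly k[2]}) m n :
  'X_(ord0) ^+ m = g * u -> 'X_(ord_max) ^+ n = g * v -> g \is a GRing.unit.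
Proof.
rewrite X0nE X1nE => gu gv.
have X0 (l : 'X_{1..2}) : 'X_[l] != 0 :> {mpoly k[2]}.
  by apply/eqP => /(congr1 (mcoeff l)); rewrite mcoeffX eqxx mcoeff0 => /eqP; rewrite oner_eq0.
have [g0 u0] : g != 0 /\ u != 0.
  by apply/andP; rewrite -negb_or -mulf_eq0 -gu X0.
have v0 : v != 0 by apply: contra (X0 (mon2 0 n)); rewrite gv => /eqP ->; rewrite mulr0.
have /mnmP lu : mon2 m 0 = (mlead g + mlead u)%MM by rewrite -mleadM // -gu mleadXm.
have /mnmP lv : mon2 0 n = (mlead g + mlead v)%MM by rewrite -mleadM // -gv mleadXm.
have lg : mlead g = 0%MM.
  apply/mnmP => i; rewrite mnmE; case: i => [[|[|//]]] i1.
    have := lv (Ordinal i1); rewrite mnmDE mnmE /=.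
    by move/esym/eqP; rewrite addn_eq0 => /andP[/eqP].
  have := lu (Ordinal i1); rewrite mnmDE mnmE /=.
  by move/esym/eqP; rewrite addn_eq0 => /andP[/eqP].
have /msize_poly1P[c c0 ->] : msize g == 1%N by rewrite -mlead_deg // lg mdeg0.
by apply: rmorph_unit; rewrite unitfE.
Qed.

(** If [g^2] divides the form, [g] divides both partials, hence the whole Jacobian ideal, in
    particular [x^(2d-3)] and [y^(2d-3)]; so [g] is a unit. *)
Lemma reduced_homogenize (k : fieldType) d (F : {poly k}) :
  (1 < d)%N -> d%:R != 0 :> k -> separable_poly F -> (d <= size F <= d.+1)%N ->
  reduced (homogenize d F).
Proof.
move=> d1 d0 sepF /[dup] sF /andP[_ sFd].
split; first by rewrite homogenize_neq0 // separable_poly_neq0.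
move=> g [_ gU _] [h fE]; apply: (negP gU).
have gderiv i : exists u, mderiv i (homogenize d F) = g * u.
  exists (mderiv i g * h *+ 2 + g * mderiv i h).
  rewrite fE expr2 !mderivM; ring.
have [u0] := gderiv ord0; rewrite homogenize_deriv ?(ltnW d1) // => u0E.
have [u1] := gderiv ord_max; rewrite homogenize_dehom_dy ?(ltnW d1) // => u1E.
have gdvd (w : {poly k}) : (size w <= d.-1.*2)%N -> exists u, homogenize (d.-1.*2).-1 w = g * u.
  move=> sw; have [a [b [sa sb ->]]] := jacobian_bezout d0 sepF sF sw.
  have -> : ((d.-1.*2).-1 = d.-2 + d.-1)%N by lia.
  exists (homogenize d.-2 a * u0 + homogenize d.-2 b * u1).
  have dE : (d.-2.+1 = d.-1)%N by lia.
  have dE' : (d.-1.+1 = d)%N by lia.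
  rewrite linearD /= !homogenizeM ?dE ?dE' ?size_dehom_dy ?u0E ?u1E //; first ring.
  by rewrite -ltnS (leq_trans (lt_size_deriv (separable_poly_neq0 sepF))).
have [|u uE] := gdvd 'X^((d.-1.*2).-1); first by rewrite size_polyXn; lia.
have [|v vE] := gdvd 'X^0; first by rewrite size_polyXn; lia.
rewrite homogenizeXn // subnn -X0nE in uE.
rewrite homogenizeXn // subn0 -X1nE in vE.
exact: dvd_both_powers_unit uE vE.
Qed.

(** * The F-pure threshold *)

(** For the form [f] of degree [d] attached to [F], this says that [f^N] lies in
    [(x^(p^e), y^(p^e))]. *)
Definition frob_pow (k : nzRingType) (p d : nat) (F : {poly k}) (e N : nat) : Prop :=
  frob_mem (d * N) (p ^ e) (F ^+ N).

(** Membership thus depends only on [N / p^e], which allows common denominators. *)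
Lemma frob_pow_shift (k : fieldType) p d (F : {poly k}) e s N :
  p \in [pchar k] ->
  frob_pow p d F (e + s) (N * p ^ s) <-> frob_pow p d F e N.
Proof.
move=> pk; elim: s => [|s IHs]; first by rewrite addn0 muln1.
rewrite -IHs addnS !expnSr mulnA /frob_pow expnSr mulnA exprM.
exact: frob_mem_frobenius.
Qed.

Lemma frob_pow0 (k : nzRingType) p d (F : {poly k}) e :
  (0 < p)%N -> ~ frob_pow p d F e 0.
Proof.
move=> p0 /(_ 0%N); rewrite muln0 add0n expn_gt0 p0 expr0 coef1 => /(_ isT isT).
by move/eqP; rewrite oner_eq0.
Qed.

(* The first exponent lies strictly between [N * p] and [N.+1 * p], so [p] does
   not divide it. *)
Lemma frob_pow_step (k : fieldType) p d (F : {poly k}) e M N :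
  p \in [pchar k] -> (1 < d)%N -> d%:R != 0 :> k ->
  separable_poly F -> (d <= size F <= d.+1)%N ->
  ~ frob_pow p d F e N -> (M < N.+1 * p)%N -> frob_pow p d F e.+1 M ->
  (2 * p ^ e.+1 + 2 <= d * M + d)%N.
Proof.
move=> pk d1 d0 sepF sF FN MN FM; have /andP[_ sFd] := sF.
have p0 : (0 < p)%N := prime_gt0 (pcharf_prime pk).
have exM : exists m, `[< frob_pow p d F e.+1 m >] by exists M; apply/asboolP.
case: (ex_minnP exM) => m /asboolP Fm mmin.
have mM : (m <= M)%N by apply: mmin; apply/asboolP.
have m0 : (0 < m)%N by rewrite lt0n; apply/eqP => m0; move: Fm; rewrite m0; exact: frob_pow0.
have Nm : (N * p < m)%N.
  rewrite ltnNge; apply/negP => mN; apply: FN.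
  by apply/(@frob_pow_shift _ p _ _ _ 1) => //; rewrite addn1 expn1; apply: frob_mem_exp_le mN Fm.
apply: (@leq_trans (d * m + d)); last by rewrite leq_add2r leq_mul2l mM orbT.
apply: (@first_frob_mem_bound _ _ _ _ _ F pk) => //.
  apply/negP => /dvdnP[j mE]; move: Nm (leq_ltn_trans mM MN).
  by rewrite mE !ltn_pmul2r // ltnS => /leq_trans/[apply]; rewrite ltnn.
move=> Fm1; have /mmin : `[< frob_pow p d F e.+1 m.-1 >] by apply/asboolP.
by lia.
Qed.

(* [trunc_num p d e / p ^ e] is the truncation of [2 / d] at [e]. *)
Definition trunc_num (p d e : nat) : nat := ((2 * p ^ e).-1 %/ d)%N.

(** Taking the predecessor before dividing makes the first inequality strict, as a non-terminating
    expansion demands. *)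
Lemma trunc_numP p d e : (0 < p)%N -> (0 < d)%N ->
  (d * trunc_num p d e < 2 * p ^ e <= d * trunc_num p d e + d)%N.
Proof.
move=> p0 d0; have q0 : (0 < p ^ e)%N by rewrite expn_gt0 p0.
rewrite /trunc_num; set n := (2 * p ^ e).-1.
have := divn_eq n d; have := ltn_pmod n d0; rewrite [(_ * d)%N]mulnC.
by rewrite /n; lia.
Qed.

(** [L] is the least level at which the power [trunc_num p d L] lies in the ideal. Non-membership
    one level below feeds [frob_pow_step], so [N] is the first exponent at [L]; the same bound then
    propagates to [N * p ^ s] at the higher levels. *)
Lemma frob_pow_dichotomy (k : fieldType) p d (F : {poly k}) e0 N0 :
  p \in [pchar k] -> (2 < d)%N -> d%:R != 0 :> k ->
  separable_poly F -> (d <= size F <= d.+1)%N ->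
  frob_pow p d F e0 N0 -> (d * N0 < 2 * p ^ e0)%N ->
  exists L N, [/\ (0 < L)%N, (0 < N)%N, (d * N < 2 * p ^ L <= d * N + d)%N,
    frob_pow p d F L N & forall s, ~ frob_pow p d F (L + s) (N * p ^ s).-1].
Proof.
move=> pk d2 d0 sepF sF FN0 N0q; have d1 := ltnW d2; have /andP[_ sFd] := sF.
have p0 : (0 < p)%N := prime_gt0 (pcharf_prime pk).
have tP e := trunc_numP e p0 (ltnW d1).
have exL : exists e, `[< frob_pow p d F e (trunc_num p d e) >].
  exists e0; apply/asboolP; apply: frob_mem_exp_le FN0 => //.
  have /andP[_ le] := tP e0; have := leq_trans N0q le.
  by rewrite -mulnSr ltn_pmul2l ?(ltnW d1).
case: (ex_minnP exL) => -[|L] /asboolP FL Lmin.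
  (* Level 0 is excluded: [trunc_num] is 0 there, and [f^0 = 1] is not in the ideal. *)
  move: FL; rewrite /trunc_num expn0 muln1 (@divn_small 1) //.
  by move/frob_pow0 => /(_ p0).
set N := trunc_num p d L.+1 in FL.
have /andP[Nlo Nhi] := tP L.+1; rewrite -/N in Nlo Nhi.
have FL1 : ~ frob_pow p d F L (trunc_num p d L).
  by move=> FL'; have : (L < L)%N by [apply/Lmin/asboolP]; rewrite ltnn.
have N_gt0 : (0 < N)%N.
  by rewrite lt0n; apply/eqP => N0'; move: FL; rewrite N0'; exact: frob_pow0.
have low M : (M < (trunc_num p d L).+1 * p)%N -> frob_pow p d F L.+1 M -> (N <= M)%N.
  move=> MN FM; have := frob_pow_step pk d1 d0 sepF sF FL1 MN FM.
  move=> le; rewrite -ltnS -(ltn_pmul2l (ltnW d1)) mulnSr.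
  by apply: leq_trans Nlo (leq_trans _ le); rewrite leq_addr.
exists L.+1, N; split=> // [|s]; first exact/andP.
elim: s => [|s IHs].
  rewrite addn0 expn0 muln1 => FN1; have /andP[_ le] := tP L.
  have le' : (N <= (trunc_num p d L).+1 * p)%N.
    rewrite -(leq_pmul2l (ltnW d1)) mulnA (leq_trans (ltnW Nlo)) //.
    by rewrite expnSr mulnA leq_pmul2r // mulnSr.
  by have := low N.-1; rewrite prednK // => /(_ le' FN1); rewrite leqNgt prednK // leqnn.
rewrite addnS => FS; have ps0 : (0 < N * p ^ s)%N by rewrite muln_gt0 N_gt0 expn_gt0 p0.
rewrite expnSr mulnA in FS; set x := (N * p ^ s)%N in ps0 IHs FS.
have xp0 : (0 < x * p)%N by rewrite muln_gt0 ps0.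
(* If the power [x * p - 1] were in the ideal, [d * (x * p)] would exceed [2 * p ^ (L.+1 + s).+1],
   against [d * N < 2 * p ^ L.+1]. *)
have := frob_pow_step pk d1 d0 sepF sF IHs _ FS.
rewrite !prednK // leqnn -(mulnSr d) prednK // => /(_ isT).
suff : (d * (x * p) <= 2 * p ^ (L.+1 + s).+1)%N by lia.
rewrite expnSr !mulnA leq_mul2r; apply/orP; right.
by rewrite /x expnD !mulnA leq_mul2r ltnW ?orbT.
Qed.

Lemma fpt_homogenize (R : realType) (k : fieldType) p d (F : {poly k}) L N :
  p \in [pchar k] -> (size F <= d.+1)%N -> (0 < N)%N ->
  frob_pow p d F L N -> (forall s, ~ frob_pow p d F (L + s) (N * p ^ s).-1) ->
  fpt R p (homogenize d F) = N%:R / p%:R ^+ L.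
Proof.
move=> pk sF N0 FN Fs; have p_pr := pcharf_prime pk.
have p0 : (0 < p)%N := prime_gt0 p_pr.
have pX_gt0 j : 0 < p%:R ^+ j :> R by rewrite exprn_gt0 // ltr0n.
have idealE e M : monomial_ideal (p ^ e) (homogenize d F ^+ M) <-> frob_pow p d F e M.
  rewrite homogenizeX //; apply: monomial_ideal_homogenize.
  exact: size_exp_leq.
rewrite /fpt; set S := [set _ | _].
(* Over the common denominator [p ^ (L + e)], a ratio above [N / p ^ L] means a higher power, which
   stays in the ideal. *)
have ubS : ubound S (N%:R / p%:R ^+ L).
  move=> _ [M [e [FM ->]]]; rewrite leNgt; apply/negP => NM; apply: FM.
  apply/idealE/(@frob_pow_shift _ p _ _ _ L) => //.
  have: frob_pow p d F (L + e) (N * p ^ e) by apply/frob_pow_shift.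
  rewrite addnC; apply: frob_mem_exp_le => //.
  move: NM; rewrite ltr_pdivrMr // mulrAC ltr_pdivlMr // -!natrX -!natrM ltr_nat.
  exact: ltnW.
(* The exponents [N * p ^ s - 1] give members of [S] approaching [N / p ^ L] from below. *)
have Ss s : S (N%:R / p%:R ^+ L - (p%:R ^+ (L + s))^-1).
  exists (N * p ^ s).-1, (L + s)%N; split; first by move/idealE; exact: Fs.
  rewrite -subn1 natrB ?muln_gt0 ?N0 ?expn_gt0 ?p0 // mulrBl mul1r; congr (_ - _).
  by rewrite natrM natrX exprD invfM mulrACA mulfV ?mulr1 // gt_eqF.
have hS : has_sup S.
  by split; [exists (N%:R / p%:R ^+ L - (p%:R ^+ (L + 0))^-1) | exists (N%:R / p%:R ^+ L)].
apply/eqP; rewrite eq_le; apply/andP; split.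
  by apply: ge_sup; [case: hS | ].
rewrite leNgt; apply/negP => lt_sup.
pose eps := N%:R / p%:R ^+ L - sup S; have eps0 : 0 < eps by rewrite subr_gt0.
have [s sP] : exists s : nat, (p%:R ^+ s)^-1 < eps.
  exists (Num.truncn eps^-1).
  rewrite -[ltRHS]invrK ltf_pV2 ?posrE ?invr_gt0 //.
  apply: lt_le_trans (truncnS_gt _) _; rewrite -natrX ler_nat.
  exact: ltn_expl (prime_gt1 p_pr).
have := ub_le_sup (proj2 hS) (Ss s); rewrite leNgt => /negP; apply.
rewrite ltrBrDl -ltrBrDr (le_lt_trans _ sP) // lef_pV2 ?posrE //.
by rewrite ler_eXn2l ?leq_addl // ltr1n prime_gt1.
Qed.

Lemma fpt_truncation (R : realType) (k : fieldType) p d (F : {poly k}) e0 N0 :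
  p \in [pchar k] -> (2 < d)%N -> d%:R != 0 :> k ->
  separable_poly F -> (d <= size F <= d.+1)%N ->
  frob_pow p d F e0 N0 -> (d * N0 < 2 * p ^ e0)%N ->
  exists2 L : nat, (0 < L)%N &
    fpt R p (homogenize d F) = truncation p (2%:R / d%:R) L.
Proof.
move=> pk d2 d0 sepF sF FN0 N0q; have p_gt1 := prime_gt1 (pcharf_prime pk).
have [L [N [L0 N0' /andP[Nlo Nhi] FN Fs]]] :=
  frob_pow_dichotomy pk d2 d0 sepF sF FN0 N0q.
exists L => //; rewrite (fpt_homogenize R pk _ N0' FN Fs); last by case/andP: sF.
have dR : 0 < d%:R :> R by rewrite ltr0n ltnW // ltnW.
have qR : 0 < p%:R ^+ L :> R by rewrite exprn_gt0 // ltr0n ltnW.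
apply/esym/truncationP => //.
  by rewrite divr_gt0 // ler_pdivrMr // mul1r ler_nat ltnW.
rewrite subr_gt0 ltr_pdivrMr // mulrAC ltr_pdivlMr //.
rewrite lerBlDl -[X in _ + X]mul1r -mulrDl ler_pdivrMr // mulrAC ler_pdivlMr //.
rewrite natr1 -!natrX -!natrM ltr_nat ler_nat.
by rewrite [(N * d)%N]mulnC [(N.+1 * d)%N]mulnC (mulnSr d) Nlo.
Qed.

(** * A reduced form with vanishing critical coefficient *)

(** A weak, coordinate-free form of polynomial function; restrictions to lines suffice for choosing
    points in general position. *)
Definition poly_on_lines (k : nzRingType) (V : lmodType k) (f : V -> k) : Prop :=
  forall u w : V, exists P : {poly k}, forall t, f (u + t *: w) = P.[t].

Lemma poly_on_lines_cst (k : nzRingType) (V : lmodType k) (c : k) :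
  poly_on_lines (fun _ : V => c).
Proof. by move=> u w; exists c%:P => t; rewrite hornerC. Qed.

Lemma poly_on_linesD (k : nzRingType) (V : lmodType k) (f g : V -> k) :
  poly_on_lines f -> poly_on_lines g -> poly_on_lines (fun v => f v + g v).
Proof.
move=> fP gP u w; have [P PE] := fP u w; have [Q QE] := gP u w.
by exists (P + Q) => t; rewrite hornerD PE QE.
Qed.

Lemma poly_on_linesM (k : comNzRingType) (V : lmodType k) (f g : V -> k) :
  poly_on_lines f -> poly_on_lines g -> poly_on_lines (fun v => f v * g v).
Proof.
move=> fP gP u w; have [P PE] := fP u w; have [Q QE] := gP u w.
by exists (P * Q) => t; rewrite hornerM PE QE.
Qed.

Lemma poly_on_lines_sum (k : nzRingType) (V : lmodType k) (I : Type)
    (r : seq I) (A : pred I) (f : I -> V -> k) :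
  (forall i, poly_on_lines (f i)) -> poly_on_lines (fun v => \sum_(i <- r | A i) f i v).
Proof.
move=> fP u w; elim: r => [|i r [Q QE]].
  by exists 0 => t; rewrite big_nil horner0.
have [P PE] := fP i u w; exists (if A i then P + Q else Q) => t.
by rewrite big_cons; case: ifP; rewrite // hornerD PE QE.
Qed.

Lemma poly_on_lines_prod (k : comNzRingType) (V : lmodType k) (I : Type)
    (r : seq I) (A : pred I) (f : I -> V -> k) :
  (forall i, poly_on_lines (f i)) -> poly_on_lines (fun v => \prod_(i <- r | A i) f i v).
Proof.
move=> fP u w; elim: r => [|i r [Q QE]].
  by exists 1 => t; rewrite big_nil hornerC.
have [P PE] := fP i u w; exists (if A i then P * Q else Q) => t.
by rewrite big_cons; case: ifP; rewrite // hornerM PE QE.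
Qed.

Lemma poly_on_lines_entry (k : comNzRingType) m n (i : 'I_m) (j : 'I_n) :
  poly_on_lines (fun v : 'M[k]_(m, n) => v i j).
Proof.
move=> u w; exists ((u i j)%:P + w i j *: 'X) => t.
by rewrite !mxE hornerD hornerC hornerZ hornerX mulrC.
Qed.

(* The line through a point with [f != 0] and a point with [g != 0] meets both
   loci in the complement of a finite set. *)
Lemma poly_on_lines_meet (k : closedFieldType) (V : lmodType k) (f g : V -> k) :
  poly_on_lines f -> poly_on_lines g ->
  (exists u, f u != 0) -> (exists w, g w != 0) -> exists v, f v * g v != 0.
Proof.
move=> fP gP [u fu] [w gw]; have [P PE] := fP u (w - u).
have [Q QE] := gP u (w - u).
have P0 : P != 0.
  by apply: contra fu => /eqP P0; rewrite -[u]addr0 -(scale0r (w - u)) PE P0 horner0.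
have Q0 : Q != 0.
  by apply: contra gw => /eqP Q0; rewrite -[w](subrKC u) -(scale1r (w - u)) QE Q0 horner0.
have /closed_nonrootP[t PQt] : P * Q != 0 by rewrite mulf_neq0.
by exists (u + t *: (w - u)); rewrite PE QE -hornerM.
Qed.

Lemma poly_on_lines_meet_prod (k : closedFieldType) (V : lmodType k) (I : Type)
    (r : seq I) (A : pred I) (f : I -> V -> k) :
  (forall i, poly_on_lines (f i)) -> (forall i, A i -> exists v, f i v != 0) ->
  exists v, \prod_(i <- r | A i) f i v != 0.
Proof.
move=> fP f0; elim: r => [|i r IHr]; first by exists 0; rewrite big_nil oner_neq0.
have [Ai|nAi] := boolP (A i); last first.
  by have [v fv] := IHr; exists v; rewrite big_cons (negPf nAi).
have [v fv] := poly_on_lines_meet (fP i) (poly_on_lines_prod r A fP) (f0 i Ai) IHr.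
by exists v; rewrite big_cons Ai.
Qed.

Definition coefs_on_lines (k : nzRingType) (V : lmodType k) (H : V -> {poly k}) : Prop :=
  forall i, poly_on_lines (fun v => (H v)`_i).

Lemma coefs_on_linesM (k : comNzRingType) (V : lmodType k) (G H : V -> {poly k}) :
  coefs_on_lines G -> coefs_on_lines H -> coefs_on_lines (fun v => G v * H v).
Proof.
move=> GP HP i u w.
have [P PE] := @poly_on_lines_sum _ _ _ (index_enum 'I_i.+1) xpredT
  (fun j v => (G v)`_(nat_of_ord j) * (H v)`_(i - j))
  (fun j => poly_on_linesM (GP j) (HP (i - j)%N)) u w.
by exists P => t; rewrite coefM PE.
Qed.

Lemma coefs_on_lines_prod (k : comNzRingType) (V : lmodType k) (I : Type)
    (r : seq I) (H : I -> V -> {poly k}) :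
  (forall i, coefs_on_lines (H i)) -> coefs_on_lines (fun v => \prod_(i <- r) H i v).
Proof.
move=> HP; elim: r => [|i r IHr] j u w.
  by exists ((1 : {poly k})`_j)%:P => t; rewrite big_nil hornerC.
have [P PE] := coefs_on_linesM (HP i) IHr j u w.
by exists P => t; rewrite big_cons PE.
Qed.

(** * Products of linear forms in general position *)

Definition lin_form (k : nzRingType) n (v : 'M[k]_(n, 2)) (j : 'I_n) : {poly k} :=
  v j ord0 *: 'X + (v j ord_max)%:P.

Lemma coefs_on_lines_lin_form (k : comNzRingType) n (j : 'I_n) :
  coefs_on_lines (fun v : 'M[k]_(n, 2) => lin_form v j).
Proof.
move=> i u w.
have [P PE] := poly_on_linesD
  (poly_on_linesM (poly_on_lines_entry j ord0) (poly_on_lines_cst (('X : {poly k})`_i)))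
  (poly_on_linesM (poly_on_lines_entry j ord_max) (poly_on_lines_cst ((1 : {poly k})`_i)))
  u w.
by exists P => t; rewrite -PE /lin_form coefD coefZ -[_%:P]alg_polyC coefZ.
Qed.

Lemma coef_XD1_exp (k : comNzRingType) n i :
  (('X + 1 : {poly k}) ^+ n)`_i = 'C(n, i)%:R.
Proof.
rewrite exprD1n coef_sum; have [ni|ni] := ltnP n i.
  rewrite bin_small // big1 // => j _; rewrite coefMn coefXn.
  by case: eqP (ltn_ord j) => [<-|]; rewrite ?mul0rn // ltnS leqNgt ni.
rewrite (bigD1 (Ordinal (ni : i < n.+1)%N)) //= coefMn coefXn eqxx big1 ?addr0 //.
move=> j /eqP ji; rewrite coefMn coefXn; case: eqP => [ij|]; last by rewrite mul0rn.
by case: ji; apply: val_inj.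
Qed.

(** In the binomial expansion, [t^N] occurs only with [G] itself. So if [G] has a nonzero
    coefficient at [K] and [N > 0], then [P] is nonconstant and has a root over an algebraically
    closed field. *)
Lemma coef_mul_XsubC_exp (k : comNzRingType) (G : {poly k}) N K :
  exists2 P : {poly k}, P`_N = (-1) ^+ N * G`_K &
    forall t, (G * ('X - t%:P) ^+ N)`_K = P.[t].
Proof.
exists (\poly_(i < N.+1) ((-1) ^+ i * (G * 'X^(N - i))`_K *+ 'C(N, i))).
  by rewrite coef_poly ltnSn subnn binn mulr1 mulr1n.
move=> t; rewrite exprBn mulr_sumr coef_sum horner_poly; apply: eq_bigr => i _.
rewrite mulrnAr coefMn mulrnAl; congr (_ *+ _).
set Y := 'X^(N - i).
have -> : G * ((-1) ^+ i * Y * t%:P ^+ i) = ((-1) ^+ i * t ^+ i)%:P * (G * Y).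
  rewrite rmorphM !rmorphXn rmorphN1; set a := (-1) ^+ i; set b := _ ^+ i; ring.
by rewrite mul_polyC coefZ mulrAC.
Qed.

(* [m] copies of [x], [m + 1] copies of [y], then copies of [x + y]. *)
Definition base_forms (k : nzRingType) n m : 'M[k]_(n, 2) :=
  \matrix_(j, c) if (j < m)%N then (c == ord0)%:R
                 else if (j < m + m.+1)%N then (c == ord_max)%:R else 1.

Lemma prod_base_forms (k : comNzRingType) m o :
  \prod_(j < m + m.+1 + o) lin_form (base_forms k (m + m.+1 + o) m) j =
  'X^m * ('X + 1) ^+ o.
Proof.
pose l (j : nat) : {poly k} := if (j < m)%N then 'X
  else if (j < m + m.+1)%N then 1 else 'X + 1.
transitivity (\prod_(j < m + m.+1 + o) l j).
  apply: eq_bigr => j _; rewrite /lin_form /l !mxE.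
  by do 2?case: ifP => _ /=; rewrite ?scale1r ?scale0r ?addr0 ?add0r.
rewrite !big_split_ord /=.
rewrite (eq_bigr (fun=> 'X)) => [|i _]; last by rewrite /l ltn_ord.
rewrite [X in _ * X * _](eq_bigr (fun=> 1)) => [|i _]; last first.
  by rewrite /l ltnNge leq_addr /= ltn_add2l ltn_ord.
rewrite [X in _ * _ * X](eq_bigr (fun=> 'X + 1)) => [|i _]; last first.
  by rewrite /l !ltnNge leq_addr -addnA leq_addr.
by rewrite !prodr_const !card_ord expr1n mulr1.
Qed.

Lemma prod_row_perm (k : comNzRingType) n (s : {perm 'I_n}) (v : 'M[k]_(n, 2)) :
  \prod_j lin_form (row_perm s v) j = \prod_j lin_form v j.
Proof.
rewrite [RHS](reindex_inj (@perm_inj _ s)); apply: eq_bigr => j _.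
by rewrite /lin_form !mxE.
Qed.

(** Three kinds of open conditions: no factor [y], no two factors proportional, and a nonzero
    coefficient after doubling any one factor. Each holds somewhere, hence all hold at a common
    point. *)
Lemma generic_forms (k : closedFieldType) n N K (v0 : 'M[k]_(n.+1, 2)) :
  ((\prod_j lin_form v0 j * lin_form v0 ord0) ^+ N)`_K != 0 ->
  exists v : 'M[k]_(n.+1, 2),
    [/\ forall j, v j ord0 != 0,
        forall i j, i != j -> v i ord0 * v j ord_max != v j ord0 * v i ord_max &
        forall i, ((\prod_j lin_form v j * lin_form v i) ^+ N)`_K != 0].
Proof.
move=> v0P.
pose f1 (i : 'I_n.+1) (v : 'M[k]_(n.+1, 2)) := v i ord0.
pose f2 (ij : 'I_n.+1 * 'I_n.+1) (v : 'M[k]_(n.+1, 2)) :=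
  v ij.1 ord0 * v ij.2 ord_max + (-1) * (v ij.2 ord0 * v ij.1 ord_max).
pose f3 i (v : 'M[k]_(n.+1, 2)) := ((\prod_j lin_form v j * lin_form v i) ^+ N)`_K.
have f1P i : poly_on_lines (f1 i) := poly_on_lines_entry i ord0.
have f2P ij : poly_on_lines (f2 ij).
  apply: poly_on_linesD; first by apply: poly_on_linesM; exact: poly_on_lines_entry.
  apply: poly_on_linesM; first exact: poly_on_lines_cst.
  by apply: poly_on_linesM; exact: poly_on_lines_entry.
have f3P i : poly_on_lines (f3 i).
  have hP : coefs_on_lines (fun v : 'M[k]_(n.+1, 2) => \prod_j lin_form v j * lin_form v i).
    apply: coefs_on_linesM (coefs_on_lines_lin_form i).
    by apply: coefs_on_lines_prod => j; exact: coefs_on_lines_lin_form.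
  move=> u w; have [P PE] := coefs_on_lines_prod (index_enum 'I_N) (fun=> hP) K u w.
  by exists P => t; rewrite -PE prodr_const card_ord.
have [] := @poly_on_lines_meet _ _ (fun v => \prod_i f1 i v)
  (fun v => \prod_(ij | ij.1 != ij.2) f2 ij v * \prod_i f3 i v).
- exact: poly_on_lines_prod.
- by apply: poly_on_linesM; exact: poly_on_lines_prod.
- apply: poly_on_lines_meet_prod => // i _.
  by exists (const_mx 1); rewrite /f1 mxE oner_neq0.
- apply: poly_on_lines_meet.
  + exact: poly_on_lines_prod.
  + exact: poly_on_lines_prod.
  + apply: poly_on_lines_meet_prod => // -[i j] /= ij.
    (* Row [i] is the form [x] and all other rows are [y], so the determinant is 1. *)
    exists (\matrix_(l, c) ((l == i) == (c == ord0))%:R).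
    by rewrite /f2 !mxE /= !eqxx (eq_sym j) (negPf ij) /= mulr0 mulr0 addr0 mulr1 oner_neq0.
  (* Swapping rows 0 and [i] of [v0] makes row [i] the doubled factor and leaves the product
     unchanged. *)
  apply: poly_on_lines_meet_prod => // i _; exists (row_perm (tperm ord0 i) v0).
  by rewrite /f3 prod_row_perm {2}/lin_form !mxE tpermR.
move=> v; rewrite !mulf_eq0 !negb_or => /and3P[/prodf_neq0 v1 /prodf_neq0 v2 /prodf_neq0 v3].
exists v; split=> [j|i j ij|i]; [exact: v1 | | exact: v3].
by have := v2 (i, j) ij; rewrite /f2 mulN1r subr_eq0.
Qed.

Lemma exists_separable_coef0 (k : closedFieldType) d M :
  (4 <= d)%N -> d%:R != 0 :> k -> (0 < M)%N ->
  exists F : {poly k}, [/\ separable_poly F, (d <= size F <= d.+1)%N &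
    (F ^+ (2 * M))`_(d * M) = 0].
Proof.
move=> d4 d0 M0; set N := (2 * M)%N; set K := (d * M)%N.
(* There are [d - 1] rows; doubling row 0, a copy of [x], gives [(xy)^(m+2) (x + y)^o]. As [d >= 4],
   the subtraction in [m] is exact. *)
pose o : nat := odd d; pose m := d./2.-2.
have dE : d = (m.+1 + m.+2 + o).+1 by rewrite /m /o; lia.
have [bin0|bin_neq0] := eqVneq ('C(o * N, o * M)%:R : k) 0.
  (* An even [d] would give ['C(0, 0) = 1]. For odd [d], the coefficient for ['X^d - 1] is
     ['C(2 * M, M)] up to sign, which is 0 in this case. *)
  have o1 : o = 1%N.
    by move: bin0; rewrite /o; case: odd => //= /eqP; rewrite bin0 oner_eq0.
  exists ('X^d - 1); split; first exact: separable_Xn_sub_1.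
    by rewrite size_XnsubC ?leqnSn ?leqnn // (leq_trans _ d4).
  rewrite o1 !mul1n in bin0.
  rewrite exprBn coef_sum big1 // => i _; rewrite expr1n mulr1 coefMn -exprM.
  have -> : (-1) ^+ i = ((-1) ^+ i)%:P :> {poly k} by rewrite rmorph_sign.
  rewrite mul_polyC coefZ coefXn.
  have [|] := eqVneq K (d * (N - i))%N; last by rewrite mulr0 mul0rn.
  move/eqP; rewrite eqn_pmul2l ?(leq_trans _ d4) // => /eqP MNi.
  have -> : i = M :> nat by have := ltn_ord i; rewrite /N in MNi *; lia.
  by rewrite mulr1 -mulr_natr bin0 mulr0.
have base : ((\prod_j lin_form (base_forms k (m.+1 + m.+2 + o) m.+1) j *
    lin_form (base_forms k (m.+1 + m.+2 + o) m.+1) ord0) ^+ N)`_K != 0.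
  rewrite prod_base_forms {1}/lin_form !mxE /= scale1r addr0 mulrAC -exprSr.
  rewrite exprMn -!exprM coefXnM.
  have -> : (K < m.+2 * N)%N = false by rewrite /K /N; lia.
  have -> : (K - m.+2 * N = o * M)%N by rewrite /K /N; lia.
  by rewrite coef_XD1_exp.
have [v [v0 vdet vP]] := generic_forms base.
pose r j := - v j ord_max / v j ord0.
have formE j : lin_form v j = v j ord0 *: ('X - (r j)%:P).
  by rewrite /lin_form scalerBr -[_ *: _%:P]mul_polyC -rmorphM mulrC divfK // rmorphN opprK.
have r_inj : injective r.
  move=> i j rij; apply/eqP; apply: contraT => /vdet /eqP; case.
  move: rij => /(congr1 (fun x => - (x * (v i ord0 * v j ord0)))).
  rewrite /r !mulrA divfK // [_ * v i ord0]mulrAC divfK // !mulNr !opprK => E.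
  by rewrite [LHS]mulrC -E mulrC.
pose rs := map r (enum 'I_(m.+1 + m.+2 + o)).
have rs_uniq : uniq rs by rewrite map_inj_uniq // enum_uniq.
pose H : {poly k} := \prod_(x <- rs) ('X - x%:P).
have rs_size : size rs = d.-1 by rewrite size_map size_enum_ord dE.
have sepH : separable_poly H by rewrite separable_prod_XsubC.
have sizeH : size H = d by rewrite size_prod_XsubC rs_size prednK // (leq_trans _ d4).
(* [H] has degree [d - 1], so as a form of degree [d] it carries a simple factor [y]; if its
   coefficient vanishes, it already serves. *)
have [HK|HK] := eqVneq ((H ^+ N)`_K) 0; first by exists H; rewrite sepH sizeH leqnn leqnSn.
have [P PN PE] := coef_mul_XsubC_exp (H ^+ N) N K.
have /closed_rootP[t /rootP Pt] : size P != 1.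
  suff N_lt : (N < size P)%N by rewrite gtn_eqF // (leq_ltn_trans _ N_lt) // muln_gt0.
  rewrite ltnNge; apply/negP => /leq_sizeP/(_ N (leqnn _))/eqP.
  by rewrite PN mulf_eq0 signr_eq0 (negPf HK).
rewrite -PE -exprMn in Pt; exists (H * ('X - t%:P)); split=> //; last first.
  rewrite size_mul ?polyXsubC_eq0 ?separable_poly_neq0 // size_XsubC sizeH addn2.
  by rewrite leqnSn leqnn.
(* If [t] were the root of form [j], the new polynomial would be, up to a nonzero scalar, the
   product with form [j] doubled, whose coefficient is nonzero by genericity. *)
rewrite separable_root sepH root_prod_XsubC; apply/negP => /mapP[j _ tE].
have /eqP := vP j; apply; rewrite (eq_bigr _ (fun i _ => formE i)) formE.
rewrite scaler_prod -scalerAl -scalerAr scalerA exprZn coefZ -tE.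
suff -> : \prod_i ('X - (r i)%:P) = H by rewrite Pt mulr0.
by rewrite /H big_map big_enum.
Qed.

Theorem theorem5p3 (R : realType) (k : closedFieldType) (p : nat)
    (char_k : p \in [pchar k]) (d : nat) (d_ge4 : (4 <= d)%N)
    (p_ndvd_d : ~~ (p %| d)%N) :
  (exists f : {mpoly k[2]},
     [/\ f \is d.-homog, reduced f &
         exists2 L : nat, (0 < L)%N &
           fpt R p f = truncation p (2%:R / d%:R) L]) /\
  (exists2 L : nat, (0 < L)%N &
     [set f : {mpoly k[2]} |
        [/\ f \is d.-homog, reduced f &
            fpt R p f = truncation p (2%:R / d%:R) L]] !=set0).
Proof.
have p_pr := pcharf_prime char_k; have p_gt1 := prime_gt1 p_pr.
have d_gt0 : (0 < d)%N by rewrite (leq_trans _ d_ge4).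
have d0 : d%:R != 0 :> k by rewrite -(dvdn_pcharf char_k).
pose e := totient d.
have /eqP q_mod : (p ^ e == 1 %[mod d])%N.
  by apply/eqP/Euler_exp_totient; rewrite prime_coprime.
have q_gt1 : (1 < p ^ e)%N by rewrite -(expn0 p) ltn_exp2l // totient_gt0.
have /dvdnP[M qE] : (d %| p ^ e - 1)%N by rewrite -eqn_mod_dvd ?q_mod // ltnW.
rewrite mulnC in qE.
have M_gt0 : (0 < M)%N by rewrite -(ltn_pmul2l d_gt0) muln0 -qE subn_gt0.
have [F [sepF sF FM]] := exists_separable_coef0 d_ge4 d0 M_gt0.
(* In degree [2 d M = 2 (p^e - 1)] the only monomial outside the ideal is [(xy)^(d M)]. *)
have F_pow : frob_pow p d F e (2 * M).
  move=> i iq; rewrite mulnCA => qi.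
  by have -> : i = (d * M)%N by lia.
have small : (d * (2 * M) < 2 * p ^ e)%N by rewrite mulnCA; lia.
have [L L_gt0 FL] := fpt_truncation R char_k (ltnW d_ge4) d0 sepF sF F_pow small.
have homF := homogenize_dhomog d F.
have redF := reduced_homogenize (ltnW (ltnW d_ge4)) d0 sepF sF.
split; first by exists (homogenize d F); split=> //; exists L.
by exists L => //; exists (homogenize d F).
Qed.
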